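(* Let $\mathcal{N} = (\mathcal{L}, \mathcal{A})$ be a network model that is valid for a multiobjective discrete optimization problem, with arc weights $w(a) \in \mathbb{R}^K$. Let $u_1, u_2 \in \mathcal{L}$, $u_1 \ne u_2$, be two nodes in $\mathcal{N}$ for which there exists a one-to-one mapping (bijection) between the arcs in $\mathcal{A}^+(u_1)$ and the arcs in $\mathcal{A}^+(u_2)$ satisfying that, for every pair of arcs $(a_1, a_2)$ such that $a_1 \in \mathcal{A}^+(u_1)$ maps to $a_2 \in \mathcal{A}^+(u_2)$, we have $t(a_1) = t(a_2)$ and $w(a_1) = w(a_2)$. Then the following sequence of operations characterizes a validity-preserving operation: (1) delete all arcs in $\mathcal{A}^+(u_2)$; (2) redefine $t(a) = u_1$ for all $a \in \mathcal{A}^-(u_2)$; (3) delete $u_2$. That is, if $\mathcal{N}'$ denotes the resulting network, then $\mathrm{PF}(\mathcal{N}) = \mathrm{PF}(\mathcal{N}')$.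
   Context: Dominance: for $y, y' \in \mathbb{R}^K$, $y$ dominates $y'$ (written $y \succ y'$) if $y_k \ge y'_k$ for all $k \in \{1,\dots,K\}$ and $y_{k} > y'_{k}$ for at least one $k$. For a set $S \subseteq \mathbb{R}^K$, $\mathrm{ND}(S) := \{ y \in S : \nexists\, y' \in S \text{ with } y' \succ y\}$. Multiobjective discrete optimization problem: $\max\{ f(x) = (f_1(x),\dots,f_K(x)) : x \in \mathcal{X}\}$, where $\mathcal{X} \subset \mathbb{Z}^n$ is a bounded feasible set and $f : \mathcal{X} \to \mathbb{R}^K$. Its Pareto frontier (set of nondominated points) is $\mathcal{Y}_N := \mathrm{ND}(\{f(x) : x \in \mathcal{X}\})$. Network model: a layered acyclic multi-digraph $\mathcal{N} = (\mathcal{L}, \mathcal{A})$ (parallel arcs allowed). The node set $\mathcal{L}$ is partitioned into $n+1$ non-empty layers $\mathcal{L}_1, \dots, \mathcal{L}_{n+1}$, with $\mathcal{L}_1 = \{\mathbf{r}\}$ (root) and $\mathcal{L}_{n+1} = \{\mathbf{t}\}$ (terminal). Each arc $a$ is directed from its arc-root $r(a) \in \mathcal{L}_j$ to its arc-terminal $t(a) \in \mathcal{L}_{j+1}$ for some $j \in \{1,\dots,n\}$, and has a weight vector $w(a) \in \mathbb{R}^K$. $\mathcal{A}^+(u) := \{a \in \mathcal{A}: r(a) = u\}$ is the set of outgoing arcs of $u$ and $\mathcal{A}^-(u) := \{a \in \mathcal{A}: t(a) = u\}$ the set of incoming arcs. Paths are directed and specified by their sequences of arcs; the weight $w(p)$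 of a path $p$ is the sum of the weights of its arcs. $\mathcal{P}$ is the set of paths from $\mathbf{r}$ to $\mathbf{t}$. The Pareto frontier of $\mathcal{N}$ is $\mathrm{PF}(\mathcal{N}) := \mathrm{ND}(\{ w(p) : p \in \mathcal{P}\})$. The network model $\mathcal{N}$ is valid for a multiobjective discrete optimization problem if $\mathrm{PF}(\mathcal{N}) = \mathcal{Y}_N$. Validity-preserving operation: an operation transforming a network $\mathcal{N}$ into a smaller network $\mathcal{N}'$ such that $\mathrm{PF}(\mathcal{N}) = \mathrm{PF}(\mathcal{N}')$.
   Formalization: It is additionally assumed that neither u_1 nor u_2 is the terminal t (otherwise t could be paired with a node without outgoing arcs, and the claim fails); N' is shown to be again a layered network when A^+(u_1) is non-empty or u_1, u_2 lie in the same layer. *)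

(* Defs.v *)
From mathcomp Require Import all_boot all_order all_algebra.
From mathcomp Require Import classical_sets reals.

Set Implicit Arguments.
Unset Strict Implicit.
Unset Printing Implicit Defensive.

Local Open Scope ring_scope.

Definition dominates (R : realType) (K : nat) (y y' : 'rV[R]_K) : Prop :=
  (forall k, y' 0 k <= y 0 k) /\ (exists k, y' 0 k < y 0 k).

Definition ND (R : realType) (K : nat) (S : set 'rV[R]_K) : set 'rV[R]_K :=
  [set y | S y /\ ~ (exists y', S y' /\ dominates y' y)]%classic.

Definition bounded_int (n : nat) (X : set 'rV[int]_n) : Prop :=
  exists M : int, forall x, X x -> forall i, `|x 0 i| <= M.

(* The objective is a total function; only its values on [X] matter. *)
Definition modo_frontier (R : realType) (K n : nat)
    (X : set 'rV[int]_n) (f : 'rV[int]_n -> 'rV[R]_K) : set 'rV[R]_K :=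
  ND (f @` X)%classic.

(* Raw data of a finite multi-digraph with labelled nodes.  The nodes and arcs
   are finite subsets of the ambient types [V] and [E], so that deleting a node
   or an arc does not change the types; [E] is a type of arc names, hence
   parallel arcs, even of equal weight, are allowed.  The maps [arc_root],
   [arc_term], [weight] and [layer] are only meaningful on [arcs] and [nodes].
   Layers are numbered from 0 to n.  The layering axioms are in
   [network_model]. *)
Record network (R : realType) (K n : nat) (V E : finType) := Network {
  nodes : {set V};
  arcs : {set E};
  arc_root : E -> V;
  arc_term : E -> V;
  weight : E -> 'rV[R]_K;
  layer : V -> 'I_n.+1;
  root : V;
  terminal : V }.

Section Network.
Variables (R : realType) (K n : nat) (V E : finType).
Implicit Types N : network R K n V E.

Definition layer_set N (j : 'I_n.+1) : {set V} :=
  [set u in nodes N | layer N u == j].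

Definition out_arcs N (u : V) : {set E} := [set a in arcs N | arc_root N a == u].

Definition in_arcs N (u : V) : {set E} := [set a in arcs N | arc_term N a == u].

(* Acyclicity is a consequence of the last condition. *)
Definition network_model N : Prop :=
  [/\ layer_set N ord0 = [set root N],
      layer_set N ord_max = [set terminal N],
      (forall j, layer_set N j != finset.set0) &
      forall a, a \in arcs N ->
        [/\ arc_root N a \in nodes N, arc_term N a \in nodes N &
            layer N (arc_term N a) = (layer N (arc_root N a)).+1 :> nat]].

Fixpoint is_path N (u : V) (p : seq E) (v : V) : bool :=
  if p is a :: p' then
    [&& a \in arcs N, arc_root N a == u & is_path N (arc_term N a) p' v]
  else u == v.

Definition path_weight N (p : seq E) : 'rV[R]_K := \sum_(a <- p) weight N a.

Definition PF N : set 'rV[R]_K :=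
  ND [set path_weight N p | p in [set p | is_path N (root N) p (terminal N)]]%classic.

Definition valid_for N (X : set 'rV[int]_n) (f : 'rV[int]_n -> 'rV[R]_K) : Prop :=
  PF N = modo_frontier X f.

Definition delete_out_arcs N (u : V) : network R K n V E :=
  Network (nodes N) (arcs N :\: out_arcs N u) (arc_root N) (arc_term N)
    (weight N) (layer N) (root N) (terminal N).

Definition redirect_in_arcs N (u1 u2 : V) : network R K n V E :=
  Network (nodes N) (arcs N) (arc_root N)
    (fun a => if a \in in_arcs N u2 then u1 else arc_term N a)
    (weight N) (layer N) (root N) (terminal N).

Definition delete_node N (u : V) : network R K n V E :=
  Network (nodes N :\ u) (arcs N) (arc_root N) (arc_term N)
    (weight N) (layer N) (root N) (terminal N).

Definition merge_nodes N (u1 u2 : V) : network R K n V E :=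
  delete_node (redirect_in_arcs (delete_out_arcs N u2) u1 u2) u2.

Definition arc_matching N (u1 u2 : V) (phi : E -> E) : Prop :=
  [/\ {in out_arcs N u1 &, injective phi},
      phi @: out_arcs N u1 = out_arcs N u2 &
      forall a, a \in out_arcs N u1 ->
        arc_term N a = arc_term N (phi a) /\ weight N a = weight N (phi a)].

Definition smaller N' N : Prop :=
  (#|nodes N'| < #|nodes N|)%N /\ (#|arcs N'| <= #|arcs N|)%N.

Definition validity_preserving N N' : Prop := smaller N' N /\ PF N = PF N'.

End Network.

(* Main.v *)
(* Every root-terminal path of one network is turned into a root-terminal path
   of the other with the same weight.  A path of N leaving u2 by an arc phi a
   is made to leave u1 by a instead; conversely, where a path of the merged
   network enters u1 through a redirected arc, its next arc a is replaced by
   phi a.  The two frontiers are thus those of the same set of weights. *)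
Require Import Defs.
From mathcomp Require Import all_boot all_order all_algebra.
From mathcomp Require Import classical_sets reals.

Set Implicit Arguments.
Unset Strict Implicit.
Unset Printing Implicit Defensive.

Local Open Scope ring_scope.

Section Merge.
Variables (R : realType) (K n : nat) (V E : finType).
Variables (N : network R K n V E) (u1 u2 : V) (phi : E -> E).
Hypotheses (Hu12 : u1 <> u2) (Hphi : arc_matching N u1 u2 phi).

Local Notation N' := (merge_nodes N u1 u2).

Lemma path_weight_cons (M : network R K n V E) a p :
  path_weight M (a :: p) = weight M a + path_weight M p.
Proof. by rewrite /path_weight big_cons. Qed.

Lemma arc_matching_out a : a \in arcs N -> arc_root N a = u1 ->
  [/\ phi a \in arcs N, arc_root N (phi a) = u2,
      arc_term N (phi a) = arc_term N a & weight N (phi a) = weight N a].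
Proof.
move=> aN ra; have [_ im H] := Hphi.
have aO : a \in out_arcs N u1 by rewrite inE aN ra eqxx.
have [-> ->] := H a aO.
have : phi a \in out_arcs N u2 by rewrite -im imset_f.
by rewrite inE => /andP[-> /eqP ->].
Qed.

Lemma arc_matching_preimage b : b \in arcs N -> arc_root N b = u2 ->
  exists a, [/\ a \in arcs N, arc_root N a = u1 & b = phi a].
Proof.
move=> bN rb; have [_ im _] := Hphi.
have : b \in out_arcs N u2 by rewrite inE bN rb eqxx.
rewrite -im => /imsetP[a]; rewrite inE => /andP[aN /eqP ra] ->.
by exists a.
Qed.

Lemma merge_arcsE a : (a \in arcs N') = (a \in arcs N) && (arc_root N a != u2).
Proof. by rewrite /= !inE; case: (a \in arcs N); rewrite ?andbF ?andbT. Qed.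

Lemma merge_arc_termE a : a \in arcs N' ->
  arc_term N' a = if arc_term N a == u2 then u1 else arc_term N a.
Proof. by rewrite merge_arcsE => /andP[aN ra] /=; rewrite !inE aN ra. Qed.

(** Renaming the start node lets the induction pass through tails that begin at [u2]. Since
    [u2 <> t], the end of the path keeps its name. *)
Lemma path_to_merge t v p : u2 <> t -> is_path N v p t ->
  exists q, is_path N' (if v == u2 then u1 else v) q t /\
            path_weight N' q = path_weight N p.
Proof.
move=> u2t; elim: p v => [|a p IH] v.
  move=> /eqP ->; exists [::]; split; last by rewrite /path_weight !big_nil.
  by case: eqP => [/esym//|_]; rewrite /= eqxx.
case/and3P=> aN /eqP ra /IH[q [qP qw]].
(* Any surviving arc [b] that agrees with [a] in terminal and weight can be put in front of [q]: [a]
   itself when [v] is not [u2], a preimage of [a] under [phi] otherwise. *)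
have step b : b \in arcs N -> arc_root N b = (if v == u2 then u1 else v) ->
    arc_term N b = arc_term N a -> weight N b = weight N a ->
    exists q, is_path N' (if v == u2 then u1 else v) q t /\
              path_weight N' q = path_weight N (a :: p).
  move=> bN rb tb wb; have bN' : b \in arcs N'.
    by rewrite merge_arcsE bN rb; case: (eqVneq v u2) => // _; apply/eqP.
  exists (b :: q); split; last by rewrite !path_weight_cons qw -wb.
  by apply/and3P; split; rewrite ?merge_arc_termE ?tb // -rb.
case: (eqVneq v u2) step => [vu2|_] step; last exact: (step a).
have [b [bN rb ab]] := arc_matching_preimage aN (etrans ra vu2).
have [_ _ tb wb] := arc_matching_out bN rb.
by apply: (step b); rewrite // ab.
Qed.

Lemma path_of_merge t v p : u1 <> t -> is_path N' v p t ->
  exists q, is_path N v q t /\ path_weight N q = path_weight N' p.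
Proof.
move=> u1t; elim: p v => [|a p IH] v.
  by move=> vt; exists [::]; split; rewrite // /path_weight !big_nil.
case/and3P=> aN' ra /IH[q]; rewrite merge_arc_termE // path_weight_cons.
have aN : a \in arcs N by move: aN'; rewrite merge_arcsE => /andP[].
case: eqP => [ta|_] [qP <-]; last first.
  by exists (a :: q); split; [apply/and3P | rewrite path_weight_cons].
(* The arc [a] enters [u2] in [N], whereas [q] starts at [u1]. As [u1 <> t], [q] has a first arc
   [b], and [phi b] leaves [u2] for the same node. *)
case: q qP => [/eqP//|b q /and3P[bN /eqP rb qP]].
have [fN rf tf wf] := arc_matching_out bN rb.
exists [:: a, phi b & q]; split; last by rewrite !path_weight_cons wf.
by apply/and3P; split=> //; apply/and3P; split; rewrite // ?rf ?ta ?tf.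
Qed.

(** A matched pair of arcs shares its terminal, and every arc climbs exactly one layer. *)
Lemma arc_matching_layer : network_model N -> out_arcs N u1 <> finset.set0 ->
  layer N u1 = layer N u2.
Proof.
move=> [_ _ _ HA] /eqP/finset.set0Pn[a]; rewrite inE => /andP[aN /eqP ra].
have [fN rf tf _] := arc_matching_out aN ra.
have [_ _ La] := HA a aN; have [_ _ Lf] := HA _ fN.
by apply: val_inj; apply: succn_inj; rewrite /= -ra -rf -La -Lf tf.
Qed.

(** The root is alone in its layer. *)
Lemma same_layer_neq_root : network_model N -> u1 \in nodes N ->
  u2 \in nodes N -> layer N u1 = layer N u2 -> u2 <> Defs.root N.
Proof.
move=> [H0 _ _ _] u1N u2N L u2r.
have : u2 \in layer_set N ord0 by rewrite H0 u2r set11.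
rewrite inE => /andP[_ L2].
have : u1 \in layer_set N ord0 by rewrite inE u1N L.
by rewrite H0 inE -u2r => /eqP.
Qed.

Lemma PF_merge : network_model N -> u1 \in nodes N -> u2 \in nodes N ->
  u1 <> terminal N -> u2 <> terminal N -> PF N = PF N'.
Proof.
move=> HN u1N u2N u1t u2t; congr (ND _); apply/seteqP; split=> y [p pP <-].
(* If [u2] is the root, [path_to_merge] gives a path from [u1], while the root field of [N'] is
   still [u2]; this case is therefore refuted separately. *)
- have [u2r|u2r] := eqVneq u2 (Defs.root N); last first.
    have [q [qP qw]] := path_to_merge u2t pP.
    by rewrite eq_sym (negbTE u2r) in qP; exists q.
  (* If the root is deleted, it has no outgoing arc and N has no path. *)
  case: p pP => [/eqP rt|b p /and3P[bN /eqP rb _]]; first by case: u2t; rewrite u2r.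
  have [a [aN ra _]] := arc_matching_preimage bN (etrans rb (esym u2r)).
  have O : out_arcs N u1 <> finset.set0.
    by apply/eqP/finset.set0Pn; exists a; rewrite inE aN ra eqxx.
  by have := same_layer_neq_root HN u1N u2N (arc_matching_layer HN O).
- by have [q [qP qw]] := path_of_merge u1t pP; exists q.
Qed.

Lemma merge_smaller : u2 \in nodes N -> smaller N' N.
Proof.
move=> u2N; split; last exact/subset_leq_card/finset.subsetDl.
by rewrite [X in (_ < X)%N](cardsD1 u2) u2N.
Qed.

(** In the layer of [u2], [u1] takes its place: the layer stays non-empty and redirected arcs still
    climb one layer. *)
Lemma merge_network_model : network_model N -> u1 \in nodes N ->
  u2 \in nodes N -> u2 <> terminal N -> layer N u1 = layer N u2 ->
  network_model N'.
Proof.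
move=> HN u1N u2N u2t L.
have u2r := same_layer_neq_root HN u1N u2N L.
have [H0 Hm Hne HA] := HN.
have layerE j : layer_set N' j = layer_set N j :\ u2.
  by apply/setP => v; rewrite !inE andbA.
split.
- by rewrite layerE H0; apply/setP => v; rewrite !inE andbC;
    case: (eqVneq v (Defs.root N)) => // ->; rewrite eq_sym; apply/eqP.
- by rewrite layerE Hm; apply/setP => v; rewrite !inE andbC;
    case: (eqVneq v (terminal N)) => // ->; rewrite eq_sym; apply/eqP.
- move=> j; rewrite layerE; apply/finset.set0Pn.
  have /finset.set0Pn[v vj] := Hne j.
  have [vu2|vu2] := eqVneq v u2; last by exists v; rewrite in_setD1 vu2.
  exists u1; rewrite in_setD1 inE u1N L -vu2; move: vj; rewrite inE => /andP[_ ->].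
  by rewrite vu2 !andbT; apply/eqP.
- move=> a aN'; rewrite merge_arc_termE //.
  move: aN'; rewrite merge_arcsE => /andP[aN ra].
  have [rN tN La] := HA a aN.
  split; rewrite /= ?in_setD1 ?ra //.
  + case: (eqVneq (arc_term N a) u2) => [_|-> //]; rewrite u1N andbT; exact/eqP.
  + by case: eqP => [ta|//]; rewrite L -ta.
Qed.

End Merge.

(** The terminal has no outgoing arcs, so it is vacuously matched with any dead end; merging these
    could create or destroy paths. Likewise, two dead ends may lie in different layers, and deleting
    one may empty its layer, whence the condition in the second conjunct. *)
Theorem theorem1 (R : realType) (K n : nat)
    (X : set 'rV[int]_n) (f : 'rV[int]_n -> 'rV[R]_K) (HX : bounded_int X)
    (V E : finType) (N : network R K n V E)
    (HN : network_model N) (Hvalid : valid_for N X f)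
    (u1 u2 : V) (Hu1 : u1 \in nodes N) (Hu2 : u2 \in nodes N) (Hu12 : u1 <> u2)
    (Ht1 : u1 <> terminal N) (Ht2 : u2 <> terminal N)
    (Hphi : exists phi : E -> E, arc_matching N u1 u2 phi) :
  validity_preserving N (merge_nodes N u1 u2) /\
  (out_arcs N u1 <> finset.set0 \/ layer N u1 = layer N u2 ->
   network_model (merge_nodes N u1 u2)).
Proof.
have [phi Hm] := Hphi; split.
  by split; [exact: merge_smaller | exact: (PF_merge Hu12 Hm)].
move=> HL; apply: merge_network_model => //.
by case: HL => // O; exact: (arc_matching_layer Hm).
Qed.
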